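(* For any real numbers $[a],[b]\in\mathcal{S}_{\mathbb{R}}$, either $[a]\le[b]$ or $[b]\le[a]$.
   Context: Conventions. $\omega=\{0,1,2,\dots\}$, $\omega_+=\omega\setminus\{0\}$, $[a,b]_\omega=\{n\in\omega:a\le n\le b\}$, $[a,\infty]_\omega=\{n\in\omega:n\ge a\}$. A system function $\vartheta:\omega_+\to[2,\infty]_\omega$ is fixed. Contractions. For $f:\omega\to\omega$ and $n\in\omega_+$, the contraction $c_n$ is applicable to $f$ iff $f(n+1)\ge\vartheta(n)$, and then $c_n(f)(n)=f(n)+1$, $c_n(f)(n+1)=f(n+1)-\vartheta(n)$, $c_n(f)(k)=f(k)$ for other $k$. A sequence of contractions is a finite (possibly empty) composition of contractions; it is applicable to $f$ iff each contraction in turn is applicable to the result of the preceding ones. Sign. For $f:\omega\to\omega$, $\sigma(f)=0$ if $f(0)$ is odd and $\sigma(f)=1$ if $f(0)$ is even. Auxiliary functions. $h:\omega\to\omega$ is a primary auxiliary function ($h\in A_p$) if $h(k)<\vartheta(k-1)$ for all $k\ge2$ and for every $N\in\omega_+$ there is $M\ge N+1$ with $h(M)\ne\vartheta(M-1)-1$. It is a secondary auxiliary function ($h\in A_s$) if $h(k)<\vartheta(k-1)$ for all $k\ge2$ and there is $N\in\omega_+$ with $h(M)=\vartheta(M-1)-1$ for all $M\ge N+1$; the least such $N$ is $N^h_{\min}$. Base set. $W_1$ is the set of pairs $(h_p,h_s)\in A_p\times A_s$ such that, with $N=N^{h_s}_{\min}$, $h_p(k)=h_s(k)$ for $k<N$,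 $h_p(N)=h_s(N)+1$, and $h_p(k)=0$ for $k>N$. Two pairs in $W_1$ are equivalent if their first components agree on $\omega_+$ and have the same sign; $F$ is the collection of sets obtained by taking, for each equivalence class, the set of all functions that are components of its pairs. $W_2$ is the set of primary auxiliary functions occurring in no pair of $W_1$; two elements of $W_2$ are equivalent if they agree on $\omega_+$ and have the same sign; $G_2$ is the set of equivalence classes. The base set is $B=F\cup G_2$. Real numbers. For $b\in B$, $r_b$ is the set of $f:\omega\to\omega$ for which there is $h\in b$ such that for every $N\in\omega_+$ some sequence of contractions $\mathcal{C}$ applicable to $f$ satisfies $\mathcal{C}(f)(n)=h(n)$ for all $n\in[0,N]_\omega$. Let $b_1,b_2\in B$ be the elements containing respectively the zero function, and the function with value $1$ at $0$ and $0$ elsewhere. $\mathcal{S}_{\mathbb{R}}$ (the set of real numbers) consists of all $r_b$ with $b\in B\setminus\{b_1,b_2\}$ together with $[0]:=r_{b_1}\cup r_{b_2}$. Put $\mathcal{S}_{\mathbb{R}}^*=\mathcal{S}_{\mathbb{R}}\setminus\{[0]\}$. Distinct real numbers are disjoint. A function lying in some real number is called finite, and $[f]$ denotes the real number containing $f$. For $[a]\in\mathcal{S}_{\mathbb{R}}^*$ all elements have the same sign, denoted $\sigma([a])$. Order. For $[a],[b]\in\mathcal{S}_{\mathbb{R}}^*$, $[a]\le[b]$ iff one of the following holds: (i) $\sigma([a])<\sigma([b])$; (ii) $\sigma([a])=\sigma([b])=1$ and for every $a\in[a]$ there is $b\in[b]$ with $a(n)\le b(n)$ for all $n\in\omega_+$;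 (iii) $\sigma([a])=\sigma([b])=0$ and for every $b\in[b]$ there is $a\in[a]$ with $a(n)\ge b(n)$ for all $n\in\omega_+$. For $[a]\in\mathcal{S}_{\mathbb{R}}^*$, $[a]\le[0]$ iff $\sigma([a])=0$, and $[0]\le[a]$ iff $\sigma([a])=1$. Finally $[0]\le[0]$ holds. *)

(* Defs.v *)
From mathcomp Require Import all_boot.
From mathcomp Require Import boolp classical_sets.

Set Implicit Arguments.
Unset Strict Implicit.
Unset Printing Implicit Defensive.

Local Open Scope classical_set_scope.

(* A system function is a map [theta : nat -> nat] that is only ever evaluated
   at positive arguments; its value at 0 is irrelevant. *)
Definition system_function (theta : nat -> nat) : Prop :=
  forall n, 0 < n -> 2 <= theta n.

Definition contraction (theta : nat -> nat) (n : nat) (f : nat -> nat) :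
    nat -> nat :=
  fun k => if k == n then f n + 1
           else if k == n + 1 then f (n + 1) - theta n
           else f k.

Definition contractible (theta : nat -> nat) (n : nat) (f : nat -> nat) : bool :=
  theta n <= f (n + 1).

(* A sequence of contractions is the list of its (positive) indices, the head
   being applied first. *)
Fixpoint applicable (theta : nat -> nat) (c : seq nat) (f : nat -> nat) : bool :=
  if c is n :: c' then
    [&& 0 < n, contractible theta n f & applicable theta c' (contraction theta n f)]
  else true.

Fixpoint contract (theta : nat -> nat) (c : seq nat) (f : nat -> nat) :
    nat -> nat :=
  if c is n :: c' then contract theta c' (contraction theta n f) else f.

Definition sigma (f : nat -> nat) : nat := if odd (f 0) then 0 else 1.

Definition digit_bounded (theta h : nat -> nat) : Prop :=
  forall k, 2 <= k -> h k < theta (k - 1).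

Definition maximal_after (theta h : nat -> nat) (N : nat) : Prop :=
  forall M, N + 1 <= M -> h M = theta (M - 1) - 1.

Definition A_p (theta : nat -> nat) : set (nat -> nat) :=
  [set h | digit_bounded theta h /\
           forall N, 0 < N -> exists2 M, N + 1 <= M & h M <> theta (M - 1) - 1].

Definition A_s (theta : nat -> nat) : set (nat -> nat) :=
  [set h | digit_bounded theta h /\ exists2 N, 0 < N & maximal_after theta h N].

(* [is_N_min theta h N] : N is the least positive integer after which all the
   digits of h are maximal; such an N exists, and is unique, for h in A_s. *)
Definition is_N_min (theta h : nat -> nat) (N : nat) : Prop :=
  [/\ 0 < N, maximal_after theta h N
    & forall N', 0 < N' -> maximal_after theta h N' -> N <= N'].

Definition W1 (theta : nat -> nat) : set ((nat -> nat) * (nat -> nat)) :=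
  [set p | [/\ A_p theta p.1, A_s theta p.2 &
     exists2 N, is_N_min theta p.2 N &
       [/\ forall k, k < N -> p.1 k = p.2 k,
           p.1 N = p.2 N + 1
         & forall k, N < k -> p.1 k = 0]]].

Definition same_sign_and_digits (f g : nat -> nat) : Prop :=
  (forall n, 0 < n -> f n = g n) /\ sigma f = sigma g.

Definition F (theta : nat -> nat) : set (set (nat -> nat)) :=
  [set b | exists2 p, W1 theta p &
     b = [set f | exists q, [/\ W1 theta q, same_sign_and_digits p.1 q.1
                              & f = q.1 \/ f = q.2]]].

Definition W2 (theta : nat -> nat) : set (nat -> nat) :=
  [set h | A_p theta h /\ ~ exists2 p, W1 theta p & h = p.1 \/ h = p.2].

Definition G2 (theta : nat -> nat) : set (set (nat -> nat)) :=
  [set b | exists2 h, W2 theta h &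
     b = [set g | W2 theta g /\ same_sign_and_digits h g]].

Definition base_set (theta : nat -> nat) : set (set (nat -> nat)) :=
  F theta `|` G2 theta.

Definition r (theta : nat -> nat) (b : set (nat -> nat)) : set (nat -> nat) :=
  [set f | exists2 h, b h &
     forall N, 0 < N -> exists2 c, applicable theta c f &
       forall n, n <= N -> contract theta c f n = h n].

(* The element of the base set containing h unique by [base_elementE]
   below; the default [set0] is only taken when there is none, which does not
   happen for b1 and b2 by [b1P] and [b2P]. *)
Definition base_element (theta h : nat -> nat) : set (nat -> nat) :=
  xget set0 [set b | base_set theta b /\ b h].

Definition b1 (theta : nat -> nat) : set (nat -> nat) :=
  base_element theta (fun _ => 0).

Definition b2 (theta : nat -> nat) : set (nat -> nat) :=
  base_element theta (fun n => if n == 0 then 1 else 0).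

Definition real_zero (theta : nat -> nat) : set (nat -> nat) :=
  r theta (b1 theta) `|` r theta (b2 theta).

Definition S_R (theta : nat -> nat) : set (set (nat -> nat)) :=
  (r theta @` (base_set theta `\` [set b1 theta; b2 theta]))
    `|` [set real_zero theta].

Definition S_R_star (theta : nat -> nat) : set (set (nat -> nat)) :=
  S_R theta `\` [set real_zero theta].

(* The sign of a chosen element of x; by [real_signE] below, the choice does not
   matter on [S_R_star]. *)
Definition real_sign (x : set (nat -> nat)) : nat :=
  sigma (xget (fun _ => 0) x).

Definition real_le (theta : nat -> nat) (x y : set (nat -> nat)) : Prop :=
  [\/ [/\ S_R_star theta x, S_R_star theta y &
        [\/ real_sign x < real_sign y,
            [/\ real_sign x = 1, real_sign y = 1 &
              forall f, x f -> exists2 g, y g & forall n, 0 < n -> f n <= g n]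
          | [/\ real_sign x = 0, real_sign y = 0 &
              forall g, y g -> exists2 f, x f & forall n, 0 < n -> f n >= g n]]],
      [/\ S_R_star theta x, y = real_zero theta & real_sign x = 0],
      [/\ x = real_zero theta, S_R_star theta y & real_sign y = 1]
    | x = real_zero theta /\ y = real_zero theta].

Lemma contract0 theta c f : applicable theta c f -> contract theta c f 0 = f 0.
Proof.
elim: c f => //= n c IH f /and3P[n0 _ /IH ->].
by case: n n0 {IH}.
Qed.

Lemma base_set_sigma theta b f g :
  base_set theta b -> b f -> b g -> sigma f = sigma g.
Proof.
have W10 p : W1 theta p -> sigma p.1 = sigma p.2.
  by case=> _ _ [N [N0 _ _] [E _ _]]; rewrite /sigma E.
case=> [[p Wp ->]|[h Wh ->]] /=; last by move=> [_ [_ <-]] [_ [_ <-]].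
have key u : (exists q, [/\ W1 theta q, same_sign_and_digits p.1 q.1
    & u = q.1 \/ u = q.2]) -> sigma u = sigma p.1.
  by move=> [q [Wq [_ ->] [->|->]]] //; rewrite -W10.
by move=> /key -> /key ->.
Qed.

Lemma real_signE theta x f : S_R_star theta x -> x f -> real_sign x = sigma f.
Proof.
move=> [[[b [Bb _] <-]|//] _] xf; rewrite /real_sign.
have rE u : r theta b u -> exists2 h, b h & sigma u = sigma h.
  move=> [h bh /(_ 1 isT)[c cu E]]; exists h => //.
  by rewrite /sigma -(contract0 cu) E.
have /rE[h bh ->] : r theta b (xget (fun=> 0) (r theta b)) by apply: xgetI xf.
by have [h' bh' ->] := rE _ xf; apply: base_set_sigma Bb _ _.
Qed.

Lemma A_pN theta h : A_p theta h -> ~ A_s theta h.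
Proof. by move=> [_ P] [_ [N N0 S]]; have [M /S] := P N N0. Qed.

Lemma W1_fun theta p q : W1 theta p -> W1 theta q -> p.2 = q.2 -> p.1 = q.1.
Proof.
move=> [_ _ [N [N0 mN lN] [E1 E2 E3]]] [_ _ [N' [N0' mN' lN'] [E1' E2' E3']]] e.
rewrite -e in mN' lN' E1' E2'.
have NN' : N' = N by apply/eqP; rewrite eqn_leq lN // lN'.
rewrite {}NN' in E1' E2' E3'; apply/funext => k.
case: (ltngtP k N) => [lt|lt|->].
- by rewrite E1 // E1'.
- by rewrite E3 // E3'.
- by rewrite E2 E2'.
Qed.

Lemma base_set_disjoint theta b b' h :
  base_set theta b -> base_set theta b' -> b h -> b' h -> b = b'.
Proof.
have tr f g u : same_sign_and_digits f u -> same_sign_and_digits g u ->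
    forall v, same_sign_and_digits f v -> same_sign_and_digits g v.
  move=> [fu sfu] [gu sgu] v [fv sfv]; split; last by rewrite sgu -sfu.
  by move=> n n0; rewrite gu // -fu // fv.
case=> [[p Wp ->]|[f Wf ->]]; case=> [[p' Wp' ->]|[f' Wf' ->]] /=.
- move=> [q [Wq Eq hq]] [q' [Wq' Eq' hq']].
  have qq' : q.1 = q'.1.
    have [[Pq Sq _] [Pq' Sq' _]] := (Wq, Wq').
    case: hq hq' => -> [] e //.
    + by case: (A_pN Pq); rewrite e.
    + by case: (A_pN Pq'); rewrite -e.
    + exact: W1_fun Wq Wq' e.
  rewrite -qq' in Eq'.
  by apply/seteqP; split=> u [v [Wv Ev hv]]; exists v; split=> //;
    [exact: tr Eq Eq' _ Ev|exact: tr Eq' Eq _ Ev].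
- by move=> [q [Wq _ hq]] [[_ []]]; exists q.
- by move=> [[_ W] _] [q [Wq _ hq]]; case: W; exists q.
- move=> [_ E] [_ E'].
  by apply/seteqP; split=> u [Wu Eu]; split=> //;
    [exact: tr E E' _ Eu|exact: tr E' E _ Eu].
Qed.

Lemma base_elementE theta b h :
  base_set theta b -> b h -> base_element theta h = b.
Proof.
move=> Bb bh; rewrite /base_element; case: xgetP => [c _ [Bc ch]|/(_ b)[]//].
exact: base_set_disjoint Bc Bb ch bh.
Qed.

Lemma zero_digits_W2 theta h : system_function theta ->
  (forall n, 0 < n -> h n = 0) -> W2 theta h.
Proof.
move=> th h0; have Ph : A_p theta h.
  split=> [[|[|k]] // _|N N0].
    by rewrite h0 // subn1 /=; apply: leq_trans (th k.+1 isT).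
  exists (N + 1) => //; rewrite addn1 h0 // subSS subn0 => /esym/eqP.
  by rewrite subn_eq0 leqNgt th.
split=> // -[p [Pp Sp [N [N0 _ _] [_ E _]]] [] e].
  by have := h0 N N0; rewrite e E addn1.
by case: (A_pN Ph); rewrite e.
Qed.

Lemma b1P theta : system_function theta ->
  base_set theta (b1 theta) /\ b1 theta (fun _ => 0).
Proof.
move=> th; have W : W2 theta (fun=> 0) by apply: zero_digits_W2.
set b := [set g | W2 theta g /\ same_sign_and_digits (fun=> 0) g].
have Bb : base_set theta b by right; exists (fun=> 0).
have bh : b (fun=> 0) by [].
by rewrite /b1 (base_elementE Bb bh).
Qed.

Lemma b2P theta : system_function theta ->
  base_set theta (b2 theta) /\ b2 theta (fun n => if n == 0 then 1 else 0).
Proof.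
move=> th; set h := fun n => _.
have W : W2 theta h by apply: zero_digits_W2 => // -[].
set b := [set g | W2 theta g /\ same_sign_and_digits h g].
have Bb : base_set theta b by right; exists h.
have bh : b h by [].
by rewrite /b2 (base_elementE Bb bh).
Qed.

(* Main.v *)
Require Import Defs.
From mathcomp Require Import all_boot zify.
From mathcomp Require Import boolp classical_sets.

Set Implicit Arguments.
Unset Strict Implicit.
Unset Printing Implicit Defensive.

(** A function f stands for the mixed-radix expansion with value
    V f = sum_(n > 0) f n / (theta 1 * ... * theta (n - 1)).  A contraction
    preserves V, never decreases a truncation of it, and every truncation can be
    normalized to have proper digits; hence the elements of a real number with
    primary representative h are, up to the value at 0, exactly the f with
    V f = V h.  If V h1 <= V h2 and V f = V h1, then adding to f an expansion e
    of V h2 - V h1 gives a pointwise larger g with V g = V h2, so totality of the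
    order reduces to comparing truncations of h1 and h2.  Working with the integer
    numerators of the truncations avoids real numbers throughout. *)

(* Numerator of the n-th truncation of V f over theta 1 * ... * theta (n - 1). *)
Fixpoint numer (theta f : nat -> nat) (n : nat) : nat :=
  if n is n'.+1 then theta n' * numer theta f n' + f n else 0.

(** The ratio of the denominators of the truncations at [m] and at [k]. *)
Definition scale (theta : nat -> nat) (k m : nat) : nat :=
  \prod_(k <= i < m) theta i.

Definition reduces_to (theta f h : nat -> nat) : Prop :=
  forall N, 0 < N -> exists2 c, applicable theta c f &
    forall n, n <= N -> contract theta c f n = h n.

(* V f = V h, provided the digits of h are bounded and not eventually maximal.
   The index k = 0 is excluded because theta 0 is a junk value, possibly 0. *)
Definition same_value (theta f h : nat -> nat) : Prop :=
  (forall n, numer theta f n <= numer theta h n) /\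
  exists c, forall k, 0 < k -> exists2 m, k <= m &
    scale theta k m * numer theta h k <= numer theta f m + c * scale theta k m.

Section Truncations.

Variable theta : nat -> nat.
Implicit Types f g h : nat -> nat.

(** * Arithmetic of truncations *)

Lemma scaleSr k m : k <= m -> scale theta k m.+1 = scale theta k m * theta m.
Proof. by move=> km; rewrite /scale big_nat_recr. Qed.

Lemma scale_cat j k m : j <= k -> k <= m ->
  scale theta j m = scale theta j k * scale theta k m.
Proof. by move=> jk km; rewrite /scale (big_cat_nat jk km). Qed.

Lemma eq_numer f g n :
  (forall k, 0 < k <= n -> f k = g k) -> numer theta f n = numer theta g n.
Proof.
elim: n => //= n IH E; rewrite E ?ltnSn // IH // => k /andP[k0 kn].
by apply: E; rewrite k0 ltnW.
Qed.

Lemma numer_addf f g n :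
  numer theta (fun k => f k + g k) n = numer theta f n + numer theta g n.
Proof. by elim: n => //= n ->; rewrite mulnDr addnACA. Qed.

Lemma numer_scale_le f k m : k <= m ->
  scale theta k m * numer theta f k <= numer theta f m.
Proof.
elim: m => [|m IH]; first by rewrite leqn0 => /eqP ->; rewrite muln0.
rewrite leq_eqVlt => /orP[/eqP ->|km].
  by rewrite /scale big_geq // mul1n.
rewrite scaleSr // mulnAC mulnC /=.
by apply: leq_trans (leq_addr _ _); rewrite leq_mul2l IH ?orbT.
Qed.

(** * Effect of contractions on truncations *)

(** The [theta i] units lost at [i + 1] are worth the one unit gained at [i], so only the truncation
    that ends between these positions changes. *)
Lemma numer_contraction i n f : 0 < i -> contractible theta i f ->
  numer theta (contraction theta i f) n = numer theta f n + (n == i).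
Proof.
rewrite /contractible => i0 fi; elim: n => [|n IH] /=; first by case: i i0 {fi}.
rewrite IH /contraction addn1 eqSS in fi *.
have [E|ni] := eqVneq n.+1 i.
  by rewrite -E ltn_eqF // addn0 addn1 addnS addn1.
have [E|_] := eqVneq n i; last by rewrite !addn0.
by rewrite E in fi *; rewrite mulnDr muln1 -addnA subnKC // addn0.
Qed.

Lemma numer_contract_ge c f n : applicable theta c f ->
  numer theta f n <= numer theta (contract theta c f) n.
Proof.
elim: c f => //= i c IH f /and3P[i0 fi /IH]; apply: leq_trans.
by rewrite numer_contraction // leq_addr.
Qed.

Lemma numer_contract c f : applicable theta c f ->
  exists n0, forall n, n0 <= n ->
    numer theta (contract theta c f) n = numer theta f n.
Proof.
elim: c f => [|i c IH] f /=; first by exists 0.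
move=> /and3P[i0 fi /IH[n0 E]]; exists (maxn n0 i.+1) => n.
rewrite geq_max => /andP[n0n ni].
by rewrite E // numer_contraction // gtn_eqF // addn0.
Qed.

Lemma contract_cat c1 c2 f :
  contract theta (c1 ++ c2) f = contract theta c2 (contract theta c1 f).
Proof. by elim: c1 f => /=. Qed.

Lemma applicable_cat c1 c2 f : applicable theta (c1 ++ c2) f =
  applicable theta c1 f && applicable theta c2 (contract theta c1 f).
Proof. by elim: c1 f => //= i c IH f; rewrite IH !andbA. Qed.

(** * Bounded digits and normalization *)

Hypothesis theta_sys : system_function theta.

Lemma theta_gt0 n : 0 < n -> 0 < theta n.
Proof. by move=> /theta_sys /ltnW. Qed.

Lemma scale_gt0 k m : 0 < k -> 0 < scale theta k m.
Proof.
move=> k0; rewrite /scale big_nat_cond prodn_cond_gt0 // => i.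
by rewrite andbT => /andP[ki _]; apply/theta_gt0/(leq_trans k0).
Qed.

Lemma numer_lt_scale f k m : 0 < k -> k <= m ->
  (forall j, 2 <= j <= m -> f j < theta (j - 1)) ->
  numer theta f m < scale theta k m * (numer theta f k + 1).
Proof.
move=> k0; elim: m => [|m IH] km fb; first by move: km k0; case: k.
have [->|km'] := eqVneq k m.+1.
  by rewrite /scale big_geq // mul1n addn1.
have {km'}km : k <= m by lia.
have {}IH : numer theta f m < scale theta k m * (numer theta f k + 1).
  by apply: IH => // j /andP[j2 jm]; apply: fb; rewrite j2 leqW.
have fm : f m.+1 < theta m.
  by have := fb m.+1; rewrite subn1; apply; rewrite ltnSn; lia.
rewrite scaleSr //= mulnAC mulnC.
have : theta m * (numer theta f m).+1 <=
       theta m * (scale theta k m * (numer theta f k + 1)).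
  by rewrite leq_mul2l IH orbT.
by rewrite mulnS; lia.
Qed.

(** Division by [theta] recovers the last digit as remainder and the previous numerator as
    quotient. *)
Lemma digits_inj f g n :
  (forall j, 2 <= j <= n -> f j < theta (j - 1)) ->
  (forall j, 2 <= j <= n -> g j < theta (j - 1)) ->
  numer theta f n = numer theta g n -> forall k, 0 < k <= n -> f k = g k.
Proof.
elim: n => [|[|n] IH] fb gb E k /andP[k0 kn]; first by case: k k0 kn.
  have -> : k = 1 by lia.
  (* The junk value [theta 0] only multiplies the empty numerator 0. *)
  by move: E => /=; rewrite !muln0.
have fn := fb n.+2 (leqnn _); have gn := gb n.+2 (leqnn _).
rewrite subn1 /= in fn gn.
have [E1 E2] : numer theta f n.+1 = numer theta g n.+1 /\ f n.+2 = g n.+2.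
  have th := theta_gt0 (ltn0Sn n).
  move: E; rewrite -/(theta n.+1 * numer theta f n.+1 + f n.+2 =
    theta n.+1 * numer theta g n.+1 + g n.+2) => E.
  have := congr1 (divn^~ (theta n.+1)) E; have := congr1 (modn^~ (theta n.+1)) E.
  rewrite /= ![theta _ * _]mulnC !modnMDl !divnMDl // !modn_small //.
  by rewrite !divn_small // !addn0.
have [->//|kn'] := eqVneq k n.+2.
apply: IH E1 _ _ => [j jn|j jn|]; [apply: fb|apply: gb|]; lia.
Qed.

Lemma contract_digit m f : 0 < m -> exists c, [/\ applicable theta c f,
  forall k, m.+1 < k -> contract theta c f k = f k,
  contract theta c f m.+1 < theta m &
  numer theta (contract theta c f) m.+1 = numer theta f m.+1].
Proof.
move=> m0; have [q] := ubnP (f m.+1); elim: q f => // q IH f fq.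
have [fm|fm] := ltnP (f m.+1) (theta m); first by exists [::].
have fi : contractible theta m f by rewrite /contractible addn1.
have th := theta_gt0 m0.
have [|c [ac kc dc nc]] := IH (contraction theta m f).
  by rewrite /contraction !addn1 gtn_eqF // eqxx; lia.
exists (m :: c); split=> //=; first by rewrite m0 fi.
  move=> k mk; rewrite kc // /contraction !addn1 !gtn_eqF //; exact: ltnW.
have := numer_contraction m.+1 m0 fi.
by rewrite /= in nc *; rewrite nc gtn_eqF // addn0.
Qed.

(** Carries move to the left, so digits are normalized from position [m] downwards; position 1
    absorbs the overflow and stays unbounded. *)
Lemma contract_digits m f : exists c, [/\ applicable theta c f,
  forall k, m < k -> contract theta c f k = f k,
  forall j, 2 <= j <= m -> contract theta c f j < theta (j - 1) &
  numer theta (contract theta c f) m = numer theta f m].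
Proof.
elim: m f => [|m IH] f; first by exists [::]; split=> // j; lia.
have [->|m0] := posnP m; first by exists [::]; split=> // j; lia.
have [c [ac kc dc nc]] := contract_digit f m0.
have [c' [ac' kc' dc' nc']] := IH (contract theta c f).
exists (c ++ c'); rewrite applicable_cat contract_cat ac; split=> //.
- by move=> k mk; rewrite kc' ?kc // ltnW.
- move=> j /andP[j2]; rewrite leq_eqVlt => /orP[/eqP ->|jm].
    by rewrite kc' // subn1.
  by apply: dc'; rewrite j2.
- by rewrite -nc /= nc' kc'.
Qed.

(** * Reduction in terms of numerators *)

Lemma reduces_to_numer_le f h n : reduces_to theta f h ->
  numer theta f n <= numer theta h n.
Proof.
case: n => // n /(_ n.+1 isT)[c ac E].
rewrite -(@eq_numer (contract theta c f) h) ?numer_contract_ge // => k /andP[_].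
exact: E.
Qed.

Lemma reduces_to_numer_ge f h k : 0 < k -> reduces_to theta f h ->
  exists2 m, k <= m & scale theta k m * numer theta h k <= numer theta f m.
Proof.
move=> k0 /(_ k k0)[c ac E]; have [n0 En] := numer_contract ac.
exists (maxn k n0); rewrite ?leq_maxl // -En ?leq_maxr //.
rewrite -(@eq_numer (contract theta c f) h) => [|j /andP[_]]; last exact: E.
by apply: numer_scale_le; apply: leq_maxl.
Qed.

(** Once [f] is normalized up to a late [m], its [N]-th numerator and that of [h] are both the
    quotient of [numer theta f m] by [scale theta N m]; uniqueness of digits concludes. *)
Lemma numer_reduces_to f h : digit_bounded theta h -> f 0 = h 0 ->
  (forall n, numer theta f n <= numer theta h n) ->
  (forall k, 0 < k -> exists2 m, k <= m &
    scale theta k m * numer theta h k <= numer theta f m) ->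
  reduces_to theta f h.
Proof.
move=> hb f0 fh hf N N0; have [m Nm hfm] := hf N N0.
have [c [ac _ dc nc]] := contract_digits m f.
exists c => // n nN; have [->|n0] := posnP n; first by rewrite contract0.
have hb' j : 2 <= j <= m -> h j < theta (j - 1) by move=> /andP[+ _]; apply: hb.
apply: (@digits_inj _ _ N); rewrite ?n0 //.
- by move=> j /andP[j2 jN]; apply: dc; rewrite j2 (leq_trans jN).
- by move=> j /andP[j2 _]; apply: hb.
have := numer_lt_scale N0 Nm dc; have := numer_lt_scale N0 Nm hb'.
have := numer_scale_le (contract theta c f) Nm; have := fh m.
rewrite nc; set q := scale theta N m in hfm *.
have le u v : q * u < q * (v + 1) -> u <= v.
  by rewrite ltn_pmul2l ?scale_gt0 // addn1 ltnS.
move=> fhm cf hq fq; apply/anti_leq/andP; split; apply: le.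
  exact: leq_ltn_trans cf (leq_ltn_trans fhm hq).
exact: leq_ltn_trans hfm fq.
Qed.

Lemma numer_nonzero_digit_gt h k n : 0 < k -> k < n -> h n != 0 ->
  scale theta k n * numer theta h k < numer theta h n.
Proof.
move=> k0; case: n => // n kn hn /=.
have := numer_scale_le h (kn : k <= n); rewrite scaleSr // -lt0n in hn *.
by rewrite mulnAC mulnC => /(leq_mul (leqnn (theta n))); lia.
Qed.

(** Each further nonzero digit gains at least one unit, and rescaling never shrinks the gain. *)
Lemma nonterminating_gap h k c : 0 < k ->
  (forall n, exists2 m, n < m & h m != 0) ->
  exists2 m, k <= m & scale theta k m * numer theta h k + c <= numer theta h m.
Proof.
move=> k0 nt; elim: c => [|c [m km IH]].
  by exists k; rewrite // addn0 /scale big_geq // mul1n.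
have [n mn hn] := nt m; exists n; first by rewrite (leq_trans km) // ltnW.
have m0 := leq_trans k0 km.
have := numer_nonzero_digit_gt m0 mn hn.
rewrite (scale_cat km (ltnW mn)); have := scale_gt0 n m0.
by move: IH; nia.
Qed.

(** The gap that [h'] gains between [k] and a late [n] pays for the error [c] allowed by
    [same_value] at [n]. *)
Lemma reduces_to_nonterminating f h h' : digit_bounded theta h' -> f 0 = h' 0 ->
  (forall n, exists2 m, n < m & h' m != 0) ->
  (forall n, numer theta h' n <= numer theta h n) ->
  (forall n, numer theta f n <= numer theta h' n) ->
  same_value theta f h -> reduces_to theta f h'.
Proof.
move=> hb f0 nt h'h fh' [_ [c hf]]; apply: numer_reduces_to => // k k0.
have [n kn gap] := nonterminating_gap c k0 nt.
have [m nm hfm] := hf n (leq_trans k0 kn).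
exists m; first exact: leq_trans nm.
rewrite (scale_cat kn nm); have := h'h n; nia.
Qed.

Lemma reduces_to_terminating f h N : digit_bounded theta h -> f 0 = h 0 ->
  (forall n, N < n -> h n = 0) ->
  (forall n, numer theta f n <= numer theta h n) ->
  (exists2 n, N <= n & numer theta f n = numer theta h n) -> reduces_to theta f h.
Proof.
move=> hb f0 h0 fh [n Nn E]; apply: numer_reduces_to => // k k0.
exists (maxn k n); first exact: leq_maxl.
have zero m : n <= m -> numer theta h m = scale theta n m * numer theta h n.
  elim: m => [|m IH]; first by rewrite leqn0 => /eqP ->; rewrite muln0.
  rewrite leq_eqVlt => /orP[/eqP <-|nm]; first by rewrite /scale big_geq // mul1n.
  rewrite scaleSr //= (IH nm) h0 ?(leq_ltn_trans Nn) // addn0.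
  by rewrite mulnCA mulnA.
apply: leq_trans (numer_scale_le h (leq_maxl k n)) _.
rewrite zero ?leq_maxr // -E; exact/numer_scale_le/leq_maxr.
Qed.

(** * Primary and secondary expansions *)

(** As with 1.000... and 0.999..., the maximal digits keep the secondary expansion exactly one
    last-place unit below the primary one. *)
Lemma W1_numer p : W1 theta p -> exists2 N, forall k, N < k -> p.1 k = 0 &
  forall n, numer theta p.1 n = numer theta p.2 n + (N <= n).
Proof.
case=> _ _ [N [N0 mN _] [E1 E2 E3]]; exists N => //; elim=> [|n IH] /=.
  by rewrite leqNgt N0.
rewrite IH; have [nN|nN|E] := ltngtP n.+1 N.
- by rewrite (leqNgt N n) ltnW // !addn0 E1.
- have Nn : N <= n by [].
  rewrite Nn mulnDr E3 // mN; last by rewrite addn1.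
  rewrite subSS subn0.
  have := theta_gt0 (leq_trans N0 (nN : N <= n)); lia.
- by rewrite E E2 leqNgt -E ltnSn /=; lia.
Qed.

Lemma same_value_reduces_to f h u :
  (forall n, numer theta u n <= numer theta h n) ->
  (forall n, numer theta h n <= numer theta u n + 1) ->
  reduces_to theta f u -> same_value theta f h.
Proof.
move=> uh hu fu; split=> [n|].
  exact: leq_trans (reduces_to_numer_le n fu) (uh n).
exists 1 => k k0; have [m km ufm] := reduces_to_numer_ge k0 fu.
by exists m => //; have := hu k; nia.
Qed.

Definition lower_expansion h N : nat -> nat := fun k =>
  if k < N then h k else if k == N then h N - 1 else theta (k - 1) - 1.

(** This leaves in [W2] only nonterminating functions and those that vanish at all positive
    positions. *)
Lemma W1_terminating h N : digit_bounded theta h -> 0 < N -> h N != 0 ->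
  (forall k, N < k -> h k = 0) -> W1 theta (h, lower_expansion h N).
Proof.
move=> hb N0 hN h0; set l := lower_expansion h N.
have lN : l N = h N - 1 by rewrite /l /lower_expansion ltnn eqxx.
have mN : maximal_after theta l N.
  move=> k; rewrite addn1 => Nk.
  by rewrite /l /lower_expansion ltnNge ltnW // gtn_eqF.
have two k : 2 <= k -> 2 <= theta (k - 1) by move=> ?; apply: theta_sys; lia.
split=> /=.
- split=> // n n0; exists (maxn n N + 1); first by rewrite leq_add2r leq_maxl.
  rewrite h0; last by rewrite addn1 ltnS leq_maxr.
  have := two (maxn n N + 1); lia.
- split; last by exists N.
  move=> k k2; have := hb k k2; have := two k k2.
  by rewrite /l /lower_expansion; case: (ltngtP k N) => [||->]; lia.
exists N; last split.
- split=> // N' N'0 mN'; rewrite leqNgt; apply/negP => N'N.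
  (* Maximality already at [N] would force [h N = theta (N - 1)], which is not a proper digit. *)
  have := mN' N; rewrite lN; have := hb N; lia.
- by move=> k kN; rewrite /l /lower_expansion kN.
- by rewrite lN; lia.
- by [].
Qed.

(** Contractions preserve the value at 0 and numerators ignore it, so [f] may have to be corrected
    there to match an element of [b]. *)
Lemma base_set_representative b : base_set theta b ->
  exists2 h, digit_bounded theta h &
  (forall f, r theta b f -> same_value theta f h) /\
  (forall f, same_value theta f h ->
    exists2 g, r theta b g & forall n, 0 < n -> g n = f n).
Proof.
have ext u v : same_sign_and_digits u v -> forall n,
    numer theta u n = numer theta v n.
  by move=> [uv _] n; apply: eq_numer => k /andP[k0 _]; apply: uv.
pose with0 f u : nat -> nat := fun n => if n == 0 then u else f n.
have with0E f u n : 0 < n -> with0 f u n = f n by case: n.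
have numer0 f u n : numer theta (with0 f u) n = numer theta f n.
  by apply: eq_numer => k /andP[k0 _]; apply: with0E.
have same0 f u h : same_value theta f h -> same_value theta (with0 f u) h.
  move=> [fh [c hf]]; split=> [n|]; first by rewrite numer0.
  by exists c => k /hf[m km E]; exists m => //; rewrite numer0.
case=> [[p Wp ->]|[h Wh ->]].
- have hb : digit_bounded theta p.1 by case: Wp => -[].
  exists p.1 => //; split=> f.
    move=> [u [q [Wq Eq Eu]] fu].
    have [N _ Nq] := W1_numer Wq.
    apply: (same_value_reduces_to _ _ fu) => n; rewrite (ext _ _ Eq);
      by case: Eu => ->; rewrite ?Nq ?leq_addr // ?leq_add2l ?leq_b1.
  (* f reduces to the primary function if some late truncation of f attains
     V p.1, and to the secondary one if all of them stay below. *)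
  move=> fp; have [N zN Np] := W1_numer Wp.
  have [[n Nn E]|lt] := pselect (exists2 n, N <= n &
      numer theta f n = numer theta p.1 n).
    exists (with0 f (p.1 0)); last exact: with0E.
    exists p.1; first by exists p; split=> //; left.
    apply: reduces_to_terminating zN _ _ => //.
      by move=> k; rewrite numer0; apply: fp.1.
    by exists n; rewrite ?numer0.
  exists (with0 f (p.2 0)); last exact: with0E.
  exists p.2; first by exists p; split=> //; right.
  have [_ [sb [M M0 mM]] _] := Wp.
  apply: (@reduces_to_nonterminating _ p.1) => //.
  + move=> n; exists (maxn n M + 1); first by rewrite addn1 ltnS leq_maxl.
    rewrite mM ?leq_add2r ?leq_maxr // addnK.
    by have := theta_sys (leq_trans M0 (leq_maxr n M)); lia.
  + by move=> n; rewrite Np leq_addr.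
  (* From [N] on, a truncation that misses the primary one is at most the secondary one, which is
     just one unit lower. *)
  + move=> n; rewrite numer0; have := fp.1 n; rewrite Np.
    have [Nn|_] := leqP N n; last by rewrite addn0.
    move=> fn; have : numer theta f n <> numer theta p.1 n.
      by move=> E; apply: lt; exists n.
    by rewrite Np Nn; lia.
  + exact: same0.
- have [hb _] := Wh.1.
  exists h => //; split=> f.
    move=> [u [Wu Eu] fu].
    by apply: (same_value_reduces_to _ _ fu) => n; rewrite (ext _ _ Eu) ?addn1.
  move=> fh; exists (with0 f (h 0)); last exact: with0E.
  exists h; first by split.
  have fh' n : numer theta (with0 f (h 0)) n <= numer theta h n.
    by rewrite numer0; apply: fh.1.
  have [nt|] := pselect (forall n, exists2 m, n < m & h m != 0).
    by apply: (@reduces_to_nonterminating _ h) => //; apply: same0.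
  move=> /existsNP[n /forall2NP hn].
  have {}hn m : n < m -> h m = 0.
    by move=> nm; have [//|/negP] := hn m; rewrite negbK => /eqP.
  (* Descend to the last nonzero digit of [h]: if there is one, [h] belongs to a pair of [W1], a
     contradiction; otherwise all positive positions are zero. *)
  elim: n hn => [|n IH] hn.
    by apply: (reduces_to_terminating hb _ hn) => //; exists 0.
  have [hn0|hn0] := eqVneq (h n.+1) 0.
    by apply: IH => m; rewrite leq_eqVlt => /orP[/eqP <-|/hn].
  case: Wh => _ []; exists (h, lower_expansion h n.+1); last by left.
  exact: W1_terminating.
Qed.

(** * Comparison of expansions *)

(** A lead of one unit at [k] cannot be made up by bounded digits further right. *)
Lemma numer_lt_mono g h k m : digit_bounded theta h -> k <= m ->
  numer theta h k < numer theta g k -> numer theta h m < numer theta g m.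
Proof.
move=> hb km; have [->//|k0 hg] := posnP k.
apply: leq_trans (numer_scale_le g km).
apply: leq_trans (numer_lt_scale k0 km _) _.
  by move=> j /andP[j2 _]; apply: hb.
by rewrite leq_mul2l addn1 hg orbT.
Qed.

Lemma numer_total g h : digit_bounded theta g -> digit_bounded theta h ->
  (forall n, numer theta g n <= numer theta h n) \/
  (forall n, numer theta h n <= numer theta g n).
Proof.
move=> gb hb; have [gh|/existsNP[n /negP]] :=
  pselect (forall n, numer theta g n <= numer theta h n); first by left.
rewrite -ltnNge => hgn; right=> m; rewrite leqNgt; apply/negP => ghm.
have [nm|/ltnW mn] := leqP n m.
  by have := numer_lt_mono hb nm hgn; rewrite ltnNge ltnW.
by have := numer_lt_mono gb mn ghm; rewrite ltnNge ltnW.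
Qed.

Lemma same_value_le f h1 h2 :
  digit_bounded theta h1 -> digit_bounded theta h2 ->
  (forall n, numer theta h1 n <= numer theta h2 n) -> same_value theta f h1 ->
  exists2 g, same_value theta g h2 & forall n, f n <= g n.
Proof.
move=> h1b h2b h12 [fh [c hf]].
(* Subtracting 1 from the difference of the numerators makes the digits of e
   nonnegative; it does not affect the limit. *)
pose E n := numer theta h2 n - numer theta h1 n - 1.
pose e n := if n is n'.+1 then E n - theta n' * E n' else 0.
have numer_e n : numer theta e n = E n.
  elim: n => // n IH; rewrite /= IH subnKC //.
  have [->|n0] := posnP n; first by rewrite muln0.
  (* Since [h1 n.+1] is at most [theta n - 1], a positive difference of numerators loses less than
     [theta n] to it. *)
  have := h1b n.+1; rewrite subn1 /= ltnS => /(_ n0).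
  have := h12 n; rewrite /E /=; nia.
exists (fun n => f n + e n) => [|n]; last exact: leq_addr.
split=> [n|].
  by rewrite numer_addf numer_e /E; have := fh n; have := h12 n; lia.
(* The two extra units cover the tail of [h1] past [k] and the 1 subtracted in [E]. *)
exists (c + 2) => k k0; have [m km hfm] := hf k k0; exists m => //.
rewrite numer_addf numer_e; have := numer_scale_le h2 km.
have := numer_lt_scale k0 km (fun j (jm : 2 <= j <= m) => h1b j (andP jm).1).
have := scale_gt0 m k0; have := h12 m; rewrite /E; nia.
Qed.

Lemma r_le_total b c : base_set theta b -> base_set theta c ->
  (forall f, r theta b f ->
    exists2 g, r theta c g & forall n, 0 < n -> f n <= g n) \/
  (forall g, r theta c g ->
    exists2 f, r theta b f & forall n, 0 < n -> g n <= f n).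
Proof.
have le x y h1 h2 : digit_bounded theta h1 -> digit_bounded theta h2 ->
    (forall n, numer theta h1 n <= numer theta h2 n) ->
    (forall f, r theta x f -> same_value theta f h1) ->
    (forall f, same_value theta f h2 ->
      exists2 g, r theta y g & forall n, 0 < n -> g n = f n) ->
    forall f, r theta x f ->
      exists2 g, r theta y g & forall n, 0 < n -> f n <= g n.
  move=> h1b h2b h12 xh1 yh2 f /xh1 /(same_value_le h1b h2b h12)[g /yh2[g' yg' E]].
  by move=> fg; exists g' => // n n0; rewrite E.
move=> /base_set_representative[h1 h1b [b1h b2h]].
move=> /base_set_representative[h2 h2b [c1h c2h]].
have [h12|h21] := numer_total h1b h2b.
- by left; apply: le h12 b1h c2h.
- by right; apply: le h21 c1h b2h.
Qed.

End Truncations.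

(** * Signs, zero and the total order *)

Lemma real_sign01 x : real_sign x = 0 \/ real_sign x = 1.
Proof. by rewrite /real_sign /sigma; case: odd; [left|right]. Qed.

Lemma S_R_starP theta x : S_R theta x -> x <> real_zero theta ->
  S_R_star theta x /\ exists2 b, base_set theta b & x = r theta b.
Proof. by move=> Sx x0; split=> //; case: Sx => // -[b [Bb _] <-]; exists b. Qed.

Theorem mainTheorem5 (theta : nat -> nat) (theta_sys : system_function theta)
    (a b : set (nat -> nat)) (a_real : S_R theta a) (b_real : S_R theta b) :
  real_le theta a b \/ real_le theta b a.
Proof.
have [a0|a0] := pselect (a = real_zero theta);
  have [b0|b0] := pselect (b = real_zero theta).
- by left; apply: Or44.
- have [Sb _] := S_R_starP b_real b0.
  by have [sb|sb] := real_sign01 b; [right; apply: Or42|left; apply: Or43].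
- have [Sa _] := S_R_starP a_real a0.
  by have [sa|sa] := real_sign01 a; [left; apply: Or42|right; apply: Or43].
have [Sa [x Bx ax]] := S_R_starP a_real a0.
have [Sb [y By bY]] := S_R_starP b_real b0.
have := r_le_total theta_sys Bx By; rewrite -ax -bY => xy.
have [sa|sa] := real_sign01 a; have [sb|sb] := real_sign01 b.
(* Sign 0 marks the negative numbers, where pointwise domination reverses the order. *)
- by case: xy => ?; [right|left]; apply: Or41; split=> //; apply: Or33.
- by left; apply: Or41; split=> //; apply: Or31; rewrite sa sb.
- by right; apply: Or41; split=> //; apply: Or31; rewrite sa sb.
- by case: xy => ?; [left|right]; apply: Or41; split=> //; apply: Or32.
Qed.
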